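(* Let $k\in\mathbb{N}_0$, $q\in[0,1[$ and $\tau\in[-1,1]$. Then $$\sum_{n=0}^\infty n^k q^n P_n(\tau) = \left(q\,\frac{\mathrm{d}}{\mathrm{d}q}\right)^k \phi(q) ,$$ where $\phi(q) := \dfrac{1}{\sqrt{1+q^2-2q\tau}}$.
   Context: $\mathbb{N}_0$ denotes the non-negative integers and $[0,1[$ the half-open interval $\{q\in\mathbb{R}: 0\le q<1\}$. $P_n$ is the Legendre polynomial of degree $n$ with the standard normalization $P_n(1)=1$. For fixed $\tau\in[-1,1]$, $\phi$ is regarded as a function of $q$; the formula defines a smooth function on the open interval $-1<q<1$, so its derivatives at $q=0$ make sense. The operator $\left(q\frac{\mathrm{d}}{\mathrm{d}q}\right)^k$ denotes the $k$-fold composition of the operator $g\mapsto q\,\frac{\mathrm{d}g}{\mathrm{d}q}$ (the identity for $k=0$). The convention $0^0=1$ is used for both $n^k$ and $q^n$. *)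

(* Defs.v *)
From mathcomp Require Import all_boot all_order all_algebra.
From mathcomp Require Import all_classical all_reals all_analysis.
From mathcomp Require cauchyreals.
Set Implicit Arguments.
Unset Strict Implicit.
Unset Printing Implicit Defensive.
Import Order.TTheory GRing.Theory Num.Theory.
Import numFieldNormedType.Exports.
Local Open Scope classical_set_scope.
Local Open Scope ring_scope.

(* Rodrigues' formula; the normalization P_n(1) = 1 and the degree n are
   checked by legendre1 and size_legendre. *)
Definition legendre (R : realType) (n : nat) : {poly R} :=
  (2 ^+ n * n`!%:R)^-1 *: (('X^2 - 1) ^+ n)^`(n).

(* Meaningful where the radicand is positive, in particular for -1 < q < 1 and
   -1 <= tau <= 1; elsewhere Num.sqrt and / take default values. *)
Definition phi (R : realType) (tau q : R) : R :=
  1 / Num.sqrt (1 + q ^+ 2 - 2 * q * tau).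

(* derive1 depends only on the germ of g at q, and is the derivative as soon as
   g is derivable at q. *)
Definition qddq (R : realType) (g : R -> R) : R -> R :=
  fun q => q * derive1 g q.

Lemma legendre1 (R : realType) (n : nat) : (legendre R n).[1] = 1.
Proof.
have fact_neq0 : 2 ^+ n * n`!%:R != 0 :> R.
  by rewrite mulf_neq0 ?expf_neq0 ?pnatr_eq0 // -lt0n fact_gt0.
rewrite /legendre hornerZ; apply: (mulfI fact_neq0).
rewrite mulrA mulfV // mul1r mulr1.
have Xn : ('X^2 - 1 : {poly R}) ^+ n = ('X - 1%:P) ^+ n * ('X + 1) ^+ n.
  by rewrite -exprMn -subr_sqr expr1n.
have aux (p : {poly R}) m j : (j <= m)%N ->
    exists r : {poly R}, (('X - 1%:P) ^+ m * p)^`(j) =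
      ('X - 1%:P) ^+ (m - j) * (p *+ (m ^_ j) + ('X - 1%:P) * r).
  elim: j => [_|j IH lt_jm].
    by exists 0; rewrite subn0 ffactn0 mulr1n mulr0 addr0.
  have [r Er] := IH (ltnW lt_jm); rewrite derivnS Er.
  have -> : (m - j = (m - j.+1).+1)%N by rewrite subnSK.
  set c := (m - j.+1)%N.
  exists (r *+ c.+1 + p^`() *+ (m ^_ j) + (r + ('X - 1%:P) * r^`())).
  have -> : (m ^_ j.+1 = m ^_ j * c.+1)%N by rewrite ffactnSr /c subnSK.
  rewrite derivM deriv_exp derivXsubC mul1r derivD derivMn derivM derivXsubC.
  rewrite mul1r succnK mulrnA [('X - _) ^+ c.+1]exprSr.
  rewrite mulrnAl -mulrnAr -mulrA -mulrDr; congr (_ * _).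
  by rewrite mulrnDl !mulrDr !mulrnAr !addrA.
have [r Er] := aux (('X + 1) ^+ n) n n (leqnn n).
rewrite Xn Er subnn expr0 mul1r hornerD hornerM hornerXsubC subrr mul0r addr0.
by rewrite hornerMn horner_exp hornerD hornerX hornerC ffactnn mulr_natr.
Qed.

Lemma size_legendre (R : realType) (n : nat) : size (legendre R n) = n.+1.
Proof.
have sz2 : size ('X^2 - 1 : {poly R}) = 3%N by rewrite size_XnsubC.
have szn : size (('X^2 - 1 : {poly R}) ^+ n) = (n.*2).+1.
  have mon : ('X^2 - 1 : {poly R}) \is monic by rewrite monicXnsubC.
  have := size_exp ('X^2 - 1 : {poly R}) n.
  rewrite sz2 /= mul2n => <-; rewrite prednK // size_poly_gt0.
  by rewrite monic_neq0 // monic_exp.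
have fact_neq0 : (2 ^+ n * n`!%:R)^-1 != 0 :> R.
  by rewrite invr_neq0 // mulf_neq0 ?expf_neq0 ?pnatr_eq0 // -lt0n fact_gt0.
by rewrite size_scale // cauchyreals.size_derivn szn -addnn -addnS addKn.
Qed.

(* Main.v *)
Require Import Defs.
From mathcomp Require Import all_boot all_order all_algebra.
From mathcomp Require Import all_classical all_reals all_analysis.
From mathcomp Require Import ring lra.
Import Order.TTheory GRing.Theory Num.Theory.
Import numFieldNormedType.Exports.
Local Open Scope classical_set_scope.
Local Open Scope ring_scope.

(** The theorem says that the power series with coefficients [P_n tau] has sum
    [phi tau] on the disk [|q| < 1], and that the Euler operator [q d/dq] acts
    on a power series by multiplying the [n]-th coefficient by [n].  The second
    fact is general ([iter_qddq_pseries]): a power series may be differentiated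
    term by term inside its disk of convergence, and the differentiated series
    converges there too, so the argument can be repeated [k] times.  It is run
    on the whole disk and not only on [[0, 1)], because each derivative depends
    on the previous function in a neighbourhood of [q], and [q] may be [0].

    The generating function ([legendre_generating]) rests on the three-term
    recurrence [(n+2) P_(n+2) = (2n+3) t P_(n+1) - (n+1) P_n], which is derived
    from Rodrigues' formula in [legendre_recurrence] and used twice.

    First, it shows that the quadratic form
    [(1 - t^2) P_n^2 + (P_(n+1) - t P_n)^2] does not increase with [n].  It
    starts at [1 - t^2], so [|P_n| <= 1] on [[-1, 1]] ([legendre_norm_le1]), and
    the generating series converges for [|q| < 1].

    Second, it says exactly that the sum [f] of that series satisfies
    [(1 + q^2 - 2 q t) f' = (t - q) f] ([legendre_generating_ode]).  Hence
    [f * sqrt (1 + q^2 - 2 q t)] has zero derivative on the disk, and it equals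
    its value [1] at the origin. *)

(** * The three-term recurrence from Rodrigues' formula *)

Lemma derivnXM (A : nzRingType) (p : {poly A}) (n : nat) :
  ('X * p)^`(n.+1) = 'X * p^`(n.+1) + p^`(n) *+ n.+1.
Proof.
by rewrite -commr_polyX -[p * 'X]addr0 derivnMXaddC addrC -commr_polyX.
Qed.

(** Put [u = X^2 - 1], [B_m = D^m u^m] and [E = D^n u^(n+1)].  Two identities
    link [E] to the [B_m]: applying [D^(n+1)] to [D u^(n+2) = 2(n+2) X u^(n+1)]
    expresses [B_(n+2)] through [B_(n+1)] and [E], and applying [D^n] to
    [D (X u^(n+1)) = (2n+3) u^(n+1) + 2(n+1) u^n] expresses [E] through
    [B_(n+1)] and [B_n].  Eliminating [E] gives the recurrence, which holds
    without the normalizing factor [(2^m m!)^-1] and hence over any commutative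
    ring. *)
Lemma rodrigues_recurrence (A : comNzRingType) (n : nat) :
  let B m := (('X^2 - 1 : {poly A}) ^+ m)^`(m) in
  B n.+2 = ('X * B n.+1) *+ (2 * (2 * n + 3)) - B n *+ (4 * n.+1 ^ 2).
Proof.
move=> B; pose u : {poly A} := 'X^2 - 1.
have du m : (u ^+ m.+1)^`() = ('X * u ^+ m) *+ (2 * m.+1).
  by rewrite deriv_exp derivB derivXn derivC /= -mulr_natr; ring.
have dXu : ('X * u ^+ n.+1)^`() = u ^+ n.+1 *+ (2 * n + 3) + u ^+ n *+ (2 * n.+1).
  rewrite derivM derivX du mul1r exprS -mulrnAr [X in _ + X]mulrA -expr2.
  have -> : 'X^2 = u + 1 by rewrite /u subrK.
  by move: u (u ^+ n) {du} => v w; ring.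
pose E := (u ^+ n.+1)^`(n).
have BE : B n.+2 = ('X * B n.+1 + E *+ n.+1) *+ (2 * n.+2).
  by rewrite {1}/B derivSn du derivnMn derivnXM.
have EB : 'X * B n.+1 + E *+ n.+1 = E *+ (2 * n + 3) + B n *+ (2 * n.+1).
  by rewrite -derivnXM derivSn dXu derivnD !derivnMn.
rewrite BE; move: (B n) (B n.+1) E EB {BE dXu du} => b0 b1 e EB.
(* Cancelling the n+1 copies of E common to both sides isolates E. *)
have {}EB : e *+ n.+2 = 'X * b1 - b0 *+ (2 * n.+1).
  by rewrite -(addrK (e *+ n.+1) ('X * b1)) EB; ring.
have -> : ('X * b1 + e *+ n.+1) *+ (2 * n.+2) =
   'X * b1 *+ (2 * n.+2) + (e *+ n.+2) *+ (2 * n.+1).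
  ring.
by rewrite EB; ring.
Qed.

Lemma legendre0 (R : realType) : legendre R 0 = 1.
Proof. by rewrite /legendre !expr0 fact0 mulr1 invr1 scale1r. Qed.

Lemma legendre_deg1 (R : realType) : legendre R 1 = 'X.
Proof.
rewrite /legendre expr1 derivn1 derivB derivXn derivC subr0 expr1.
by rewrite -[X in _ *: X]scaler_nat scalerA mulr1 mulVf ?scale1r ?pnatr_eq0.
Qed.

Lemma legendre_recurrence (R : realType) (n : nat) (t : R) :
  n.+2%:R * (legendre R n.+2).[t] =
  (2 * n.+1%:R + 1) * t * (legendre R n.+1).[t] - n.+1%:R * (legendre R n).[t].
Proof.
rewrite /legendre rodrigues_recurrence 2!factS !natrM.
have h1 : n`!%:R != 0 :> R by rewrite pnatr_eq0 -lt0n fact_gt0.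
have h2 : (2 : R) ^+ n != 0 by rewrite expf_neq0 ?pnatr_eq0.
have h3 : 1 + n%:R != 0 :> R by rewrite nat1r pnatr_eq0.
have h4 : 2 + n%:R != 0 :> R by rewrite -natrD pnatr_eq0.
rewrite !hornerZ hornerD hornerN !hornerMn hornerM hornerX.
move: (_.[t]) (_.[t]) (n`!%:R) h1 => b1 b0 f h1.
by rewrite !exprS; field; rewrite h1 h2 h3 h4.
Qed.

(** * The bound on [[-1, 1]] *)

(** The quadratic form [p^2 - 2 t p q + q^2] in consecutive values is symmetric,
    so it equals both [(1 - t^2) p^2 + (q - t p)^2] and
    [(1 - t^2) q^2 + (t q - p)^2].  The recurrence multiplies [t q - p] by
    [(n+1)/(n+2) <= 1] when passing to the next pair, whence the decay.  For
    [t^2 < 1] the form controls [p^2]; for [t = 1] or [t = -1] it starts at [0],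
    which forces [P_(n+1) = t P_n]. *)
Lemma legendre_norm_le1 (R : realType) (n : nat) (t : R) :
  -1 <= t <= 1 -> `|(legendre R n).[t]| <= 1.
Proof.
move=> /andP[t1 t2]; pose p m := (legendre R m).[t].
have p0 : p 0%N = 1 by rewrite /p legendre0 hornerC.
have p1 : p 1%N = t by rewrite /p legendre_deg1 hornerX.
have step m : p m.+2 - t * p m.+1 = m.+1%:R / m.+2%:R * (t * p m.+1 - p m).
  have h : m.+2%:R != 0 :> R by rewrite pnatr_eq0.
  apply: (mulfI h); rewrite mulrBr legendre_recurrence -/(p _) -/(p _).
  by field; rewrite -natrD pnatr_eq0.
have energy m : (1 - t ^+ 2) * p m ^+ 2 + (p m.+1 - t * p m) ^+ 2 <= 1 - t ^+ 2.
  elim: m => [|m IH]; first by rewrite p0 p1 mulr1 subrr expr0n addr0 expr1n mulr1.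
  apply: le_trans IH; rewrite step exprMn.
  have -> : (1 - t ^+ 2) * p m ^+ 2 + (p m.+1 - t * p m) ^+ 2 =
    (1 - t ^+ 2) * p m.+1 ^+ 2 + (t * p m.+1 - p m) ^+ 2 by ring.
  rewrite lerD2l ler_piMl ?sqr_ge0 // expr_le1 ?divr_ge0 //.
  by rewrite ler_pdivrMr ?ltr0n // mul1r ler_nat.
have [t_lt1|t_ge1] := ltP (t ^+ 2) 1.
  have := energy n; rewrite -/(p n) -(real_normK (num_real (p n))) => E.
  have : `|p n| ^+ 2 <= 1 by move: E (sqr_ge0 (p n.+1 - t * p n)); nra.
  by rewrite expr_le1.
have t1' : `|t| = 1.
  apply/eqP; rewrite eq_le ler_norml t1 t2 /= -(@expr_ge1 _ 2) ?real_normK //.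
  exact: num_real.
rewrite -/(p n); elim: n => [|n IH]; first by rewrite p0 normr1.
have -> : p n.+1 = t * p n.
  apply/eqP; rewrite -subr_eq0 -sqrf_eq0 eq_le sqr_ge0 andbT.
  by have := energy n; rewrite -(real_normK (num_real t)) t1' expr1n subrr mul0r add0r.
by rewrite normrM t1' mul1r.
Qed.

(** * Power series inside their disk of convergence *)

Lemma norm_between (R : realFieldType) (x r : R) :
  `|x| < r -> exists2 z : R, `|x| < `|z| & `|z| < r.
Proof.
move=> xr; exists ((`|x| + r) / 2); have := normr_ge0 x.
  by move=> x0; rewrite [ltRHS]ger0_norm; lra.
by move=> x0; rewrite ger0_norm; lra.
Qed.

(** The left-hand side is one term of the binomial expansion of the right-hand
    side.  Keeping [a] out of denominators makes the bound usable at the centre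
    [a = 0] of a power series. *)
Lemma lerXnD (R : realDomainType) (a d : R) (n : nat) :
  0 <= a -> 0 <= d -> n.+1%:R * a ^+ n * d <= (a + d) ^+ n.+1.
Proof.
move=> a0 d0; elim: n => [|n IH]; first by rewrite expr0 mulr1 mul1r expr1 lerDr.
have -> : n.+2%:R * a ^+ n.+1 * d = a * (n.+1%:R * a ^+ n * d) + d * a ^+ n.+1.
  by rewrite exprS; ring.
rewrite [leRHS]exprS mulrDl lerD // ler_wpM2l // lerXn2r ?nnegrE ?addr_ge0 //.
by rewrite lerDl.
Qed.

(** With [d] a part of the gap [|y| - |x|], the factor [n+1] created by
    differentiation is absorbed by the geometric gain between radius [|x|] and
    radius [|x| + d], where the original series converges absolutely. *)
Lemma is_cvg_pseries_diffs (R : realType) (c : R^nat) (x y : R) :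
  cvgn (pseries c y) -> `|x| < `|y| -> cvgn (pseries (pseries_diffs c) x).
Proof.
move=> cy xy.
pose d := (`|y| - `|x|) / 2.
have d0 : 0 < d by rewrite divr_gt0 // subr_gt0.
pose z := `|x| + d.
have z0 : 0 <= z by rewrite addr_ge0 // ltW.
have zy : `|z| < `|y|.
  by rewrite ger0_norm // /z /d; move: xy; lra.
have cz := is_cvg_pseries_inside_norm cy zy.
apply: normed_cvg.
apply: (@series_le_cvg _ _ (fun n => d^-1 * (`|c n.+1| * z ^+ n.+1))) => [n|n|n|].
- exact: normr_ge0.
- by rewrite /= mulr_ge0 ?(mulr_ge0 _ (exprn_ge0 _ _)) ?invr_ge0 ?(ltW d0).
- rewrite /= /pseries_diffs [leRHS]mulrC ler_pdivlMr // !normrM normrX.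
  rewrite ger0_norm // [leLHS](_ : _ = `|c n.+1| * (n.+1%:R * `|x| ^+ n * d)).
    by rewrite ler_wpM2l // lerXnD // ltW.
  by ring.
have cS : cvgn (series (fun n => `|c n.+1| * z ^+ n.+1)).
  move: cz; rewrite /pseries -(is_cvg_series_restrict 1) => cz.
  apply/cvg_ex; case/cvg_ex: cz => l; rewrite -cvg_shiftS => cz; exists l.
  apply: cvg_trans cz; apply: near_eq_cvg; apply: nearW => n /=.
  by rewrite big_add1.
exact: (is_cvg_seriesZ (k := d^-1) cS).
Qed.

(** Term-by-term differentiation from convergence at a single farther point: the
    two differentiated series that [pseries_snd_diffs] wants at a common point
    converge after shrinking the radius a little each time. *)
Lemma is_derive_pseries (R : realType) (c : R^nat) (x y : R) :
  cvgn (pseries c y) -> `|x| < `|y| ->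
  is_derive x 1 (fun z => limn (pseries c z)) (limn (pseries (pseries_diffs c) x)).
Proof.
move=> cy xy.
have [y1 xy1 y1y] := norm_between _ _ _ xy.
have [y2 xy2 y21] := norm_between _ _ _ xy1.
have [y3 xy3 y32] := norm_between _ _ _ xy2.
have c1 := is_cvg_pseries_inside cy y1y.
have c2 := is_cvg_pseries_diffs _ _ _ _ c1 y21.
apply: (@pseries_snd_diffs _ _ y3) => //.
- exact: is_cvg_pseries_inside c1 (lt_trans y32 y21).
- exact: is_cvg_pseries_inside c2 y32.
- exact: is_cvg_pseries_diffs c2 y32.
Qed.

(** The factor [x] undoes the index shift in [pseries_diffs], so that the Euler
    operator acts diagonally on coefficients and can be iterated. *)
Lemma cvg_pseries_euler (R : realType) (c : R^nat) (x : R) :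
  cvgn (pseries (pseries_diffs c) x) ->
  pseries (fun n => n%:R * c n) x @ \oo --> x * limn (pseries (pseries_diffs c) x).
Proof.
move=> /pseries_diffs_equiv /(cvgM (cvg_cst x)).
apply: cvg_trans; apply: near_eq_cvg; apply: nearW => n.
rewrite /= /series /= mulr_sumr; apply: eq_bigr => -[|i] _; rewrite /= ?exprS; ring.
Qed.

(** The induction on [k] needs the identity on the whole disk, since the
    derivative at [x] sees the previous iterate near [x]. *)
Lemma iter_qddq_pseries (R : realType) (c : R^nat) (r : R) (g : R -> R) :
  (forall x, `|x| < r -> pseries c x @ \oo --> g x) ->
  forall k x, `|x| < r ->
    pseries (fun n => n%:R ^+ k * c n) x @ \oo --> iter k (@qddq R) g x.
Proof.
move=> cg; elim=> [|k IH] x xr.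
  by under eq_fun do rewrite expr0 mul1r; exact: cg.
pose a n := n%:R ^+ k * c n.
have [y xy yr] := norm_between _ _ _ xr.
have ca : cvgn (pseries a y) by apply: cvgP (IH y yr).
have cda := is_cvg_pseries_diffs _ _ _ _ ca xy.
have da : is_derive x 1 (iter k (@qddq R) g) (limn (pseries (pseries_diffs a) x)).
  apply: near_eq_is_derive (is_derive_pseries _ _ _ _ ca xy).
  apply/nbhs_ballP; exists (r - `|x|); first by rewrite /= subr_gt0.
  move=> z /= xz; apply: cvg_lim => //; apply: IH.
  rewrite -[z](subrK x) (le_lt_trans (ler_normD _ _)) // -ltrBrDr distrC.
  exact: xz.
rewrite iterS /qddq derive1E (@derive_val _ _ _ _ _ _ _ da).
have := cvg_pseries_euler _ _ _ cda.
by under eq_fun do rewrite /a mulrA -exprS.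
Qed.

Lemma is_cvg_pseries_norm_le1 (R : realType) (c : R^nat) (x : R) :
  (forall n, `|c n| <= 1) -> `|x| < 1 -> cvgn (pseries c x).
Proof.
move=> c1 x1; apply: normed_cvg.
apply: (@series_le_cvg _ _ (geometric 1 `|x|)) => [n|n|n|].
- exact: normr_ge0.
- by rewrite /= mul1r exprn_ge0.
- by rewrite /= normrM normrX mul1r ler_piMl ?exprn_ge0.
- by apply: is_cvg_geometric_series; rewrite normr_id.
Qed.

Lemma lim_pseries0 (R : realType) (c : R^nat) : limn (pseries c 0) = c 0%N.
Proof.
apply: cvg_lim => //; rewrite -cvg_shiftS.
apply: cvg_near_cst; apply: nearW => n /=.
rewrite /pseries /series /= big_nat_recl // expr0 mulr1 big1 ?addr0 // => i _.
by rewrite expr0n mulr0.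
Qed.

Lemma is_derive0_cst (R : realType) (f : R -> R) (r x y : R) :
  (forall z : R, `|z| < r -> is_derive z 1 f 0) ->
  `|x| < r -> `|y| < r -> f x = f y.
Proof.
move=> df; wlog xy : x y / x <= y.
  by move=> H xr yr; have [xy|/ltW yx] := leP x y; [exact: H | exact/esym/H].
move=> xr yr.
have zr z : z \in `[x, y] -> `|z| < r.
  rewrite in_itv /= => /andP[xz zy]; move: xr yr; rewrite !ltr_norml.
  by move=> /andP[? _] /andP[_ ?]; apply/andP; split; lra.
have dfi z : z \in `]x, y[ -> is_derive z 1 f ((fun=> 0) z).
  by rewrite in_itv /= => /andP[xz zy]; apply/df/zr; rewrite in_itv /= !ltW.
have fc : {within `[x, y], continuous f}.
  by apply: derivable_within_continuous => z /zr /df.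
have [z _] := MVT_segment xy dfi fc.
by rewrite mul0r => /eqP; rewrite subr_eq0 => /eqP.
Qed.

(** * The generating function *)

(** The [n]-th partial sums of the two sides differ by three boundary terms
    ([partial]): the recurrence makes everything else telescope.  Each boundary
    term is a fixed multiple of the general term of a convergent series, so it
    tends to [0]. *)
Lemma legendre_generating_ode (R : realType) (t x : R) :
  -1 <= t <= 1 -> `|x| < 1 ->
  let P n := (legendre R n).[t] in
  (1 + x ^+ 2 - 2 * x * t) * limn (pseries (pseries_diffs P) x) =
  (t - x) * limn (pseries P x).
Proof.
move=> t1 x1 P.
have P1 n : `|P n| <= 1 by exact: legendre_norm_le1.
have cP1 y : `|y| < 1 -> cvgn (pseries P y) by exact: is_cvg_pseries_norm_le1.
have cP := cP1 x x1.
have cdP : cvgn (pseries (pseries_diffs P) x).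
  have [y xy y1] := norm_between _ _ _ x1.
  exact: is_cvg_pseries_diffs (cP1 y y1) xy.
have ceP := cvg_pseries_euler _ _ _ cdP.
pose w := 1 + x ^+ 2 - 2 * x * t.
have partial n : w * pseries (pseries_diffs P) x n - (t - x) * pseries P x n =
    t * (P n * x ^+ n) - pseries_diffs P n * x ^+ n + x * (n%:R * P n * x ^+ n).
  rewrite /pseries /series /=; elim: n => [|n IH].
    rewrite !big_nil /pseries_diffs /P legendre0 legendre_deg1 hornerC hornerX.
    by ring.
  rewrite !big_nat_recr //= /pseries_diffs legendre_recurrence -/(P _) -/(P _).
  move: IH; rewrite /pseries_diffs !mulrDr => IH.
  rewrite opprD addrACA IH /w !exprS; ring.
apply/eqP; rewrite -subr_eq0 -/w; apply/eqP.
have c0 (u : R^nat) : cvgn (series u) -> u @ \oo --> 0 by exact: cvg_series_cvg_0.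
have L : (fun n => w * pseries (pseries_diffs P) x n - (t - x) * pseries P x n) @ \oo
   --> w * limn (pseries (pseries_diffs P) x) - (t - x) * limn (pseries P x).
  by apply: cvgB; apply: cvgM => //; exact: cvg_cst.
have L0 : (fun n => t * (P n * x ^+ n) - pseries_diffs P n * x ^+ n
    + x * (n%:R * P n * x ^+ n)) @ \oo --> t * 0 - 0 + x * 0.
  apply: cvgD; [apply: cvgB; [apply: cvgM|]|apply: cvgM];
    by [exact: cvg_cst | apply: c0 => //; apply: cvgP ceP].
rewrite !mulr0 subr0 addr0 in L0.
by move: L; under eq_fun do rewrite partial; move/(cvg_unique _ L0) <-.
Qed.

(** The radicand is at least [(1 - |x|)^2]. *)
Lemma phi_radicand_gt0 (R : realType) (t x : R) :
  -1 <= t <= 1 -> `|x| < 1 -> 0 < 1 + x ^+ 2 - 2 * x * t.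
Proof.
move=> /andP[t1 t2]; rewrite ltr_norml => /andP[x1 x2].
have [x0|x0] := leP 0 x; last by nra.
by nra.
Qed.

Lemma legendre_generating (R : realType) (t x : R) :
  -1 <= t <= 1 -> `|x| < 1 ->
  limn (pseries (fun n => (legendre R n).[t]) x) = phi t x.
Proof.
move=> t1 x1; set P := fun n => _.
pose f (y : R) : R := limn (pseries P y).
pose w (y : R) := 1 + y ^+ 2 - 2 * y * t.
have w0 y : `|y| < 1 -> 0 < w y by exact: phi_radicand_gt0.
have P1 n : `|P n| <= 1 by exact: legendre_norm_le1.
have df (y : R) : `|y| < 1 -> is_derive y 1 f (limn (pseries (pseries_diffs P) y)).
  move=> y1; have [z yz z1] := norm_between _ _ _ y1.
  exact: is_derive_pseries (is_cvg_pseries_norm_le1 _ _ _ P1 z1) yz.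
have dg (y : R) : `|y| < 1 -> is_derive y 1 (fun y => f y * Num.sqrt (w y)) 0.
  move=> y1; have := df y y1 => dfy.
  have dw : is_derive y 1 w (2 * y - 2 * t).
    rewrite /w; apply: is_derive_eq.
    by rewrite /GRing.scale /=; ring.
  have wy := w0 y y1; have ds := is_derive1_sqrt wy.
  have dsw : is_derive y 1 (Num.sqrt \o w) ((2 * Num.sqrt (w y))^-1 * (2 * y - 2 * t)).
    exact: is_derive1_comp.
  apply: (is_derive_eq (is_deriveM dfy dsw)).
  have s0 : Num.sqrt (w y) != 0 by rewrite sqrtr_eq0 -ltNge.
  have /= ode := legendre_generating_ode R t y t1 y1.
  have sw : Num.sqrt (w y) ^+ 2 = w y by rewrite sqr_sqrtr ?ltW.
  rewrite /GRing.scale /=; apply: (mulfI s0); rewrite mulr0.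
  transitivity (Num.sqrt (w y) ^+ 2 * limn (pseries (pseries_diffs P) y)
                - (t - y) * f y); first by field.
  by rewrite sw /w ode subrr.
have z1 : `|0 : R| < 1 by rewrite normr0.
have := is_derive0_cst _ _ _ x 0 dg x1 z1.
rewrite {2}/f lim_pseries0 /P legendre0 hornerC mul1r.
rewrite {2}/w mulr0 mul0r subr0 expr0n addr0 sqrtr1 => fs.
apply: (canRL (mulfK _)) => //.
by rewrite sqrtr_eq0 -ltNge; exact: w0.
Qed.

Theorem theorem2p1 (R : realType) (k : nat) (q tau : R)
    (hq : 0 <= q < 1) (htau : -1 <= tau <= 1) :
  series (fun n : nat => n%:R ^+ k * q ^+ n * (legendre R n).[tau]) @ \oo
    --> iter k (@qddq R) (phi tau) q.
Proof.
have q1 : `|q| < 1 by case/andP: hq => q0 q1; rewrite ger0_norm.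
have gen x : `|x| < 1 ->
    pseries (fun n => (legendre R n).[tau]) x @ \oo --> phi tau x.
  move=> x1; rewrite -legendre_generating //.
  apply: is_cvg_pseries_norm_le1 x1 => n; exact: legendre_norm_le1.
have := iter_qddq_pseries _ _ _ _ gen k q q1.
by rewrite /pseries; under eq_fun do rewrite mulrAC.
Qed.
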